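(* Let $k\ge2$, let $\mathbb{C}\mathbb{Z}^k$ be the group $*$-algebra of $\mathbb{Z}^k$ and $\varepsilon\colon\mathbb{C}\mathbb{Z}^k\to\mathbb{C}$ the linear extension of the trivial representation. Then $(\mathbb{C}\mathbb{Z}^k,\varepsilon)$ has neither property (GC) nor property (AC).
   Context: The group $*$-algebra has involution $g^*=g^{-1}$, and $\varepsilon(g)=1$ for all group elements $g$. Put $A=\mathbb{C}\mathbb{Z}^k$. A pre-Hilbert space is a complex vector space $D$ with a positive definite inner product, linear in the second argument; $L(D)$ is the $*$-algebra of adjointable linear operators $D\to D$. For a unital $*$-representation $\pi\colon A\to L(D)$, a $\pi$-$\varepsilon$-cocycle is a linear map $\eta\colon A\to D$ with $\eta(ab)=\pi(a)\eta(b)+\eta(a)\varepsilon(b)$ for all $a,b\in A$; it is Gaussian if $\eta(ab)=\varepsilon(a)\eta(b)+\eta(a)\varepsilon(b)$ for all $a,b\in A$. A Schürmann triple is a triple $(\pi,\eta,\psi)$ of such $\pi,\eta$ and a linear functional $\psi\colon A\to\mathbb{C}$ with $\psi(a^* )=\overline{\psi(a)}$ and $\varepsilon(a)\psi(b)-\psi(ab)+\psi(a)\varepsilon(b)=-\langle\eta(a^* ),\eta(b)\rangle$ for all $a,b\in A$. (GC): every Gaussian cocycle $\eta\colon A\to D$ (any pre-Hilbert space $D$) can be completed to a Schürmann triple $(\varepsilon\operatorname{id}_D,\eta,\psi)$. (AC): every pair $(\pi,\eta)$ of a unital $*$-representation $\pi$ on a pre-Hilbert space and a $\pi$-$\varepsilon$-cocycle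 $\eta$ can be completed to a Schürmann triple $(\pi,\eta,\psi)$. *)

(* Defs.v *)
From HB Require Import structures.
From mathcomp Require Import all_boot all_order all_algebra.
From mathcomp Require Import finmap.
From mathcomp.multinomials Require Import monalg.
From mathcomp.real_closed Require Import complex.
From mathcomp Require Import reals.

Set Implicit Arguments.
Unset Strict Implicit.
Unset Printing Implicit Defensive.

Import Order.TTheory GRing.Theory Num.Theory.
Local Open Scope fset_scope.
Local Open Scope ring_scope.

HB.mixin Record Algebra_isStarAlgebra (C : numClosedFieldType) A
    of GRing.Algebra C A := {
  star : A -> A;
  starK : involutive star;
  starD : {morph star : a b / a + b};
  starZ : forall (c : C) (a : A), star (c *: a) = c^* *: star a;
  starM : forall a b : A, star (a * b) = star b * star a
}.

#[short(type="starAlgType")]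
HB.structure Definition StarAlgebra (C : numClosedFieldType) :=
  {A of GRing.Algebra C A & Algebra_isStarAlgebra C A}.

(* The group algebra C[G] of an additively written abelian group G: finitely
   supported functions G -> C with the convolution product; << c *g x >> is
   c times the basis element x.  The ring structure that monalg puts on
   {malg C[K]} is not applicable, since it requires the monoid K to have no
   units besides its identity. *)
Definition grpalg (C : numClosedFieldType) (G : zmodType) := {malg C[G]}.

HB.instance Definition _ C G := GRing.Lmodule.on (@grpalg C G).

Section GroupAlgebra.
Variables (C : numClosedFieldType) (G : zmodType).
Local Notation A := (grpalg C G).
Implicit Types (f g h : A) (x y : G) (c : C).

Definition grpalg_base c x : A := << c *g x >>.

Definition grpalg_one : A := grpalg_base 1 0.

Definition grpalg_mul f g : A :=
  \sum_(x <- msupp f) \sum_(y <- msupp g) grpalg_base (f@_x * g@_y) (x + y).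

Definition grpalg_star f : A :=
  \sum_(x <- msupp f) grpalg_base (f@_x)^* (- x).

(* The linear extension of the trivial representation x |-> 1. *)
Definition augmentation f : C := \sum_(x <- msupp f) f@_x.

Lemma grpalg_ind (P : A -> Prop) :
  P 0 -> (forall f g, P f -> P g -> P (f + g)) ->
  (forall c x, P (grpalg_base c x)) -> forall f, P f.
Proof. by move=> P0 PD PU f; rewrite [f]monalgE; apply: (big_ind P) => // x _; apply: PU. Qed.

Lemma grpalg_base0 x : grpalg_base 0 x = 0.
Proof. exact: monalgU0. Qed.

Lemma grpalg_baseD c1 c2 x :
  grpalg_base (c1 + c2) x = grpalg_base c1 x + grpalg_base c2 x.
Proof. exact: monalgUD. Qed.

Lemma grpalg_mulw (d1 d2 : {fset G}) f g :
  msupp f `<=` d1 -> msupp g `<=` d2 ->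
  grpalg_mul f g =
  \sum_(x <- d1) \sum_(y <- d2) grpalg_base (f@_x * g@_y) (x + y).
Proof.
move=> le1 le2; rewrite /grpalg_mul (big_fset_incl _ le1) /=.
  apply/eq_bigr=> x _; apply/big_fset_incl => // y _ /mcoeff_outdom ->.
  by rewrite mulr0 grpalg_base0.
move=> x _ /mcoeff_outdom fx.
by rewrite big1 // => y _; rewrite fx mul0r grpalg_base0.
Qed.

Lemma grpalg_mulUU c1 c2 x y :
  grpalg_mul (grpalg_base c1 x) (grpalg_base c2 y) =
  grpalg_base (c1 * c2) (x + y).
Proof.
by rewrite (grpalg_mulw (d1 := [fset x]) (d2 := [fset y])) ?msuppU_le //
           !big_seq_fset1 !mcoeffUU.
Qed.

Lemma grpalg_mulDl : left_distributive grpalg_mul +%R.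
Proof.
move=> f g h.
rewrite (grpalg_mulw (msuppD_le f g) (fsubset_refl (msupp h))).
rewrite (grpalg_mulw (fsubsetUl _ (msupp g)) (fsubset_refl (msupp h))).
rewrite (grpalg_mulw (fsubsetUr (msupp f) _) (fsubset_refl (msupp h))).
rewrite -big_split /=; apply/eq_bigr=> x _.
rewrite -big_split /=; apply/eq_bigr=> y _.
by rewrite mcoeffD mulrDl grpalg_baseD.
Qed.

Lemma grpalg_mulC : commutative grpalg_mul.
Proof.
move=> f g; rewrite /grpalg_mul exchange_big /=.
by apply/eq_bigr=> x _; apply/eq_bigr=> y _; rewrite mulrC addrC.
Qed.

Lemma grpalg_mulDr : right_distributive grpalg_mul +%R.
Proof. by move=> f g h; rewrite ![grpalg_mul f _]grpalg_mulC grpalg_mulDl. Qed.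

Lemma grpalg_mul0l : left_zero 0 grpalg_mul.
Proof. by move=> f; rewrite /grpalg_mul msupp0 big_seq_fset0. Qed.

Lemma grpalg_mul0r : right_zero 0 grpalg_mul.
Proof. by move=> f; rewrite grpalg_mulC grpalg_mul0l. Qed.

Lemma grpalg_mulA : associative grpalg_mul.
Proof.
move=> f g h; elim/grpalg_ind: f => [|f f' IH IH'|c x].
- by rewrite !grpalg_mul0l.
- by rewrite !grpalg_mulDl IH IH'.
elim/grpalg_ind: g => [|g g' IH IH'|c' x'].
- by rewrite !(grpalg_mul0l, grpalg_mul0r).
- by rewrite !(grpalg_mulDl, grpalg_mulDr) IH IH'.
elim/grpalg_ind: h => [|h h' IH IH'|c'' x''].
- by rewrite !grpalg_mul0r.
- by rewrite !grpalg_mulDr IH IH'.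
by rewrite !grpalg_mulUU mulrA addrA.
Qed.

Lemma grpalg_mul1 : left_id grpalg_one grpalg_mul.
Proof.
move=> f; elim/grpalg_ind: f => [|f g IH IH'|c x].
- exact: grpalg_mul0r.
- by rewrite grpalg_mulDr IH IH'.
by rewrite grpalg_mulUU mul1r add0r.
Qed.

Lemma grpalg_one_neq0 : grpalg_one != 0.
Proof. by rewrite /grpalg_one /grpalg_base monalgU_eq0 oner_eq0. Qed.

HB.instance Definition _ := GRing.Zmodule_isComNzRing.Build A
  grpalg_mulA grpalg_mulC grpalg_mul1 grpalg_mulDl grpalg_one_neq0.

Lemma grpalg_scaleU c c' x :
  c *: grpalg_base c' x = grpalg_base (c * c') x.
Proof. by apply/malgP=> y; rewrite mcoeffZ !mcoeffU mulrnAr. Qed.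

Lemma grpalg_scaleAl c f g : c *: (f * g) = (c *: f) * g.
Proof.
rewrite -[f * g]/(grpalg_mul f g) -[_ * g]/(grpalg_mul (c *: f) g).
elim/grpalg_ind: f => [|f f' IH IH'|c' x].
- by rewrite scaler0 grpalg_mul0l scaler0.
- by rewrite scalerDr !grpalg_mulDl scalerDr IH IH'.
elim/grpalg_ind: g => [|g g' IH IH'|c'' y].
- by rewrite !grpalg_mul0r scaler0.
- by rewrite !grpalg_mulDr scalerDr IH IH'.
by rewrite grpalg_mulUU !grpalg_scaleU grpalg_mulUU mulrA.
Qed.

HB.instance Definition _ := GRing.Lmodule_isLalgebra.Build C A grpalg_scaleAl.
HB.instance Definition _ := GRing.Lalgebra_isComAlgebra.Build C A.

Lemma grpalg_baseM c1 c2 x y :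
  grpalg_base c1 x * grpalg_base c2 y = grpalg_base (c1 * c2) (x + y).
Proof. exact: grpalg_mulUU. Qed.

Lemma grpalg_starw (d : {fset G}) f : msupp f `<=` d ->
  grpalg_star f = \sum_(x <- d) grpalg_base (f@_x)^* (- x).
Proof.
move=> le; apply/big_fset_incl => // x _ /mcoeff_outdom ->.
by rewrite conjC0 grpalg_base0.
Qed.

Lemma grpalg_starU c x : grpalg_star (grpalg_base c x) = grpalg_base c^* (- x).
Proof.
by rewrite (grpalg_starw (d := [fset x])) ?msuppU_le // big_seq_fset1 mcoeffUU.
Qed.

Lemma grpalg_star0 : grpalg_star 0 = 0.
Proof. by rewrite /grpalg_star msupp0 big_seq_fset0. Qed.

Lemma grpalg_starD : {morph grpalg_star : f g / f + g}.
Proof.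
move=> f g; rewrite (grpalg_starw (msuppD_le f g)).
rewrite (grpalg_starw (fsubsetUl _ (msupp g))).
rewrite (grpalg_starw (fsubsetUr (msupp f) _)).
rewrite -big_split /=; apply/eq_bigr=> x _.
by rewrite mcoeffD rmorphD grpalg_baseD.
Qed.

Lemma grpalg_starK : involutive grpalg_star.
Proof.
move=> f; elim/grpalg_ind: f => [|f g IH IH'|c x].
- by rewrite !grpalg_star0.
- by rewrite !grpalg_starD IH IH'.
by rewrite !grpalg_starU conjCK opprK.
Qed.

Lemma grpalg_starZ c f : grpalg_star (c *: f) = c^* *: grpalg_star f.
Proof.
elim/grpalg_ind: f => [|f g IH IH'|c' x].
- by rewrite scaler0 grpalg_star0 scaler0.
- by rewrite scalerDr !grpalg_starD scalerDr IH IH'.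
by rewrite grpalg_scaleU !grpalg_starU grpalg_scaleU rmorphM.
Qed.

Lemma grpalg_starM f g : grpalg_star (f * g) = grpalg_star g * grpalg_star f.
Proof.
elim/grpalg_ind: f => [|f f' IH IH'|c x].
- by rewrite mul0r grpalg_star0 mulr0.
- by rewrite mulrDl !grpalg_starD mulrDr IH IH'.
elim/grpalg_ind: g => [|g g' IH IH'|c' y].
- by rewrite mulr0 grpalg_star0 mul0r.
- by rewrite mulrDr !grpalg_starD mulrDl IH IH'.
by rewrite grpalg_baseM !grpalg_starU grpalg_baseM rmorphM opprD mulrC addrC.
Qed.

HB.instance Definition _ := Algebra_isStarAlgebra.Build C A
  grpalg_starK grpalg_starD grpalg_starZ grpalg_starM.

Lemma augmentationw (d : {fset G}) f : msupp f `<=` d ->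
  augmentation f = \sum_(x <- d) f@_x.
Proof. by move=> le; apply/big_fset_incl => // x _ /mcoeff_outdom ->. Qed.

Lemma augmentationU c x : augmentation (grpalg_base c x) = c.
Proof.
by rewrite (augmentationw (d := [fset x])) ?msuppU_le // big_seq_fset1 mcoeffUU.
Qed.

Lemma augmentationD : {morph augmentation : f g / f + g}.
Proof.
move=> f g; rewrite (augmentationw (msuppD_le f g)).
rewrite (augmentationw (fsubsetUl _ (msupp g))).
rewrite (augmentationw (fsubsetUr (msupp f) _)).
by rewrite -big_split /=; apply/eq_bigr=> x _; rewrite mcoeffD.
Qed.

Lemma augmentation0 : augmentation 0 = 0.
Proof. by rewrite /augmentation msupp0 big_seq_fset0. Qed.

Lemma augmentation1 : augmentation 1 = 1.
Proof. exact: augmentationU. Qed.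

Lemma augmentationZ c f : augmentation (c *: f) = c * augmentation f.
Proof.
elim/grpalg_ind: f => [|f g IH IH'|c' x].
- by rewrite scaler0 augmentation0 mulr0.
- by rewrite scalerDr !augmentationD mulrDr IH IH'.
by rewrite grpalg_scaleU !augmentationU.
Qed.

Lemma augmentationM : {morph augmentation : f g / f * g}.
Proof.
move=> f g; elim/grpalg_ind: f => [|f f' IH IH'|c x].
- by rewrite mul0r augmentation0 mul0r.
- by rewrite mulrDl !augmentationD mulrDl IH IH'.
elim/grpalg_ind: g => [|g g' IH IH'|c' y].
- by rewrite mulr0 augmentation0 mulr0.
- by rewrite mulrDr !augmentationD mulrDr IH IH'.
by rewrite grpalg_baseM !augmentationU.
Qed.

Lemma augmentation_star f : augmentation (star f) = (augmentation f)^*.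
Proof.
rewrite -[star f]/(grpalg_star f).
elim/grpalg_ind: f => [|f g IH IH'|c x].
- by rewrite grpalg_star0 !augmentation0 conjC0.
- by rewrite grpalg_starD !augmentationD rmorphD IH IH'.
by rewrite grpalg_starU !augmentationU.
Qed.

End GroupAlgebra.

(* {dot V for Num.conj} is linear in its first and conjugate-linear in its
   second argument; [inner] swaps the arguments, so that it is linear in the
   second one. *)
Record preHilbert (C : numClosedFieldType) := PreHilbert {
  preHilbert_sort :> lmodType C;
  preHilbert_dot : {dot preHilbert_sort for Num.conj}
}.

Definition inner (C : numClosedFieldType) (D : preHilbert C) (u v : D) : C :=
  preHilbert_dot D v u.

Section SchurmannTriples.
Variables (C : numClosedFieldType) (A : starAlgType C) (eps : A -> C).

(* Unital *-homomorphism A -> L(D).  The adjoint of an operator is unique when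
   it exists, so [star_rep_star] says both that pi a is adjointable and that
   its adjoint is pi (star a). *)
Record is_star_rep (D : preHilbert C) (pi : A -> D -> D) : Prop := IsStarRep {
  star_rep_op : forall a, linear (pi a);
  star_rep_linear : forall u, linear (pi^~ u);
  star_rep1 : forall u, pi 1 u = u;
  star_repM : forall a b u, pi (a * b) u = pi a (pi b u);
  star_rep_star : forall a u v, inner (pi (star a) u) v = inner u (pi a v)
}.

Record is_cocycle (D : preHilbert C) (pi : A -> D -> D) (eta : A -> D) : Prop :=
  IsCocycle {
  cocycle_linear : linear eta;
  cocycleM : forall a b, eta (a * b) = pi a (eta b) + eps b *: eta a
}.

(* This is the cocycle condition for pi a = eps a id_D. *)
Definition is_gaussian_cocycle (D : preHilbert C) (eta : A -> D) : Prop :=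
  linear eta /\ forall a b, eta (a * b) = eps a *: eta b + eps b *: eta a.

Definition eps_rep (D : preHilbert C) (a : A) (u : D) : D := eps a *: u.

Record is_schurmann_triple (D : preHilbert C)
    (pi : A -> D -> D) (eta : A -> D) (psi : A -> C) : Prop :=
  IsSchurmannTriple {
  schurmann_rep : is_star_rep pi;
  schurmann_cocycle : is_cocycle pi eta;
  schurmann_linear : scalar psi;
  schurmann_hermitian : forall a, psi (star a) = (psi a)^*;
  schurmann_coboundary : forall a b,
    eps a * psi b - psi (a * b) + psi a * eps b = - inner (eta (star a)) (eta b)
}.

Definition property_GC : Prop :=
  forall (D : preHilbert C) (eta : A -> D), is_gaussian_cocycle eta ->
  exists psi : A -> C, is_schurmann_triple (@eps_rep D) eta psi.

Definition property_AC : Prop :=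
  forall (D : preHilbert C) (pi : A -> D -> D) (eta : A -> D),
  is_star_rep pi -> is_cocycle pi eta ->
  exists psi : A -> C, is_schurmann_triple pi eta psi.

End SchurmannTriples.

(* Main.v *)
Require Import Defs.
From HB Require Import structures.
From mathcomp Require Import all_boot all_order all_algebra.
From mathcomp Require Import finmap.
From mathcomp.multinomials Require Import monalg.
From mathcomp.real_closed Require Import complex.
From mathcomp Require Import reals.

(** The obstruction is commutativity.  If (pi, eta, psi) is a Schuermann triple
    on the group algebra of an abelian group G, then the left-hand side of
    eps(a) psi(b) - psi(ab) + psi(a) eps(b) = - <eta(star a), eta(b)>
    is symmetric in a and b, hence so is the right-hand side
    ([schurmann_inner_sym]).  Every additive map h from G to a pre-Hilbert space
    D extends linearly to a Gaussian cocycle eta with eta(x) = h(x) on G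
    ([lin_ext_gaussian]).  As star x is the inverse of x and h(-x) = - h(x), the
    symmetry for group elements a = x and b = y reads
    <h(x), h(y)> = <h(y), h(x)>, that is, <h(x), h(y)> is real
    ([schurmann_additive_sym]).

    This fails as soon as k >= 2: take D to be the complex line and
    h(x) = x_0 + i x_1; on the first two basis vectors e_0, e_1 of Z^k one gets
    <h(e_0), h(e_1)> = i.  So (GC) fails.  A Gaussian cocycle is a cocycle for
    the *-representation a |-> eps(a) id_D, so (AC) implies (GC)
    ([property_AC_GC]) and (AC) fails too. *)

Set Implicit Arguments.
Unset Strict Implicit.
Unset Printing Implicit Defensive.

Import Order.TTheory GRing.Theory Num.Theory.
Local Open Scope fset_scope.
Local Open Scope ring_scope.

Section LinearExtension.
Variables (C : numClosedFieldType) (G : zmodType) (V : lmodType C).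
Implicit Types (h : G -> V) (f g : grpalg C G).

Definition lin_ext h f : V := \sum_(x <- msupp f) f@_x *: h x.

Lemma lin_extw h (d : {fset G}) f :
  msupp f `<=` d -> lin_ext h f = \sum_(x <- d) f@_x *: h x.
Proof.
by move=> le; apply/big_fset_incl => // x _ /mcoeff_outdom ->; rewrite scale0r.
Qed.

Lemma lin_extU h c x : lin_ext h (grpalg_base c x) = c *: h x.
Proof.
by rewrite (@lin_extw _ [fset x]) ?msuppU_le // big_seq_fset1 mcoeffUU.
Qed.

Lemma lin_extD h f g : lin_ext h (f + g) = lin_ext h f + lin_ext h g.
Proof.
rewrite (@lin_extw _ _ _ (msuppD_le f g)).
rewrite (@lin_extw _ _ _ (fsubsetUl _ (msupp g))).
rewrite (@lin_extw _ _ _ (fsubsetUr (msupp f) _)).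
by rewrite -big_split /=; apply/eq_bigr=> x _; rewrite mcoeffD scalerDl.
Qed.

Lemma lin_ext0 h : lin_ext h 0 = 0.
Proof. by rewrite /lin_ext msupp0 big_seq_fset0. Qed.

Lemma lin_extZ h c f : lin_ext h (c *: f) = c *: lin_ext h f.
Proof.
elim/grpalg_ind: f => [|f g IH IH'|c' x].
- by rewrite scaler0 lin_ext0 scaler0.
- by rewrite scalerDr !lin_extD scalerDr IH IH'.
by rewrite grpalg_scaleU !lin_extU scalerA.
Qed.

End LinearExtension.

(** Both sides of the cocycle identity are bilinear, and on group elements it
    reads h(x + y) = h(x) + h(y). *)
Lemma lin_ext_gaussian (C : numClosedFieldType) (G : zmodType)
    (D : preHilbert C) (h : {additive G -> D}) :
  is_gaussian_cocycle (@augmentation C G) (lin_ext h : grpalg C G -> D).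
Proof.
split=> [c f g|f g]; first by rewrite lin_extD lin_extZ.
elim/grpalg_ind: f => [|f f' IH IH'|c x].
- by rewrite mul0r lin_ext0 augmentation0 scale0r scaler0 addr0.
- rewrite mulrDl !lin_extD augmentationD IH IH' scalerDl scalerDr.
  by rewrite addrACA.
elim/grpalg_ind: g => [|g g' IH IH'|c' y].
- by rewrite mulr0 lin_ext0 augmentation0 scale0r scaler0 addr0.
- rewrite mulrDr !lin_extD augmentationD IH IH' scalerDl scalerDr.
  by rewrite addrACA.
rewrite grpalg_baseM !lin_extU !augmentationU raddfD scalerDr addrC.
by rewrite !scalerA [c' * c]mulrC.
Qed.

(** The product of the group algebra of an abelian group is commutative, so the
    coboundary side of the Schuermann identity does not change when a and b are
    exchanged. *)
Lemma schurmann_inner_sym (C : numClosedFieldType) (G : zmodType)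
    (D : preHilbert C) (pi : grpalg C G -> D -> D) (eta : grpalg C G -> D)
    (psi : grpalg C G -> C) :
  is_schurmann_triple (@augmentation C G) pi eta psi ->
  forall a b, inner (eta (star a)) (eta b) = inner (eta (star b)) (eta a).
Proof.
move=> triple a b; apply: oppr_inj.
rewrite -!(schurmann_coboundary triple) (mulrC b a) (mulrC (psi a)).
by rewrite (mulrC (psi b)) addrAC [RHS]addrAC (addrC (_ * psi b)).
Qed.

(** The previous symmetry at two group elements x and y: the involution turns
    the first argument into - h(x), resp. - h(y), and the signs cancel. *)
Lemma schurmann_additive_sym (C : numClosedFieldType) (G : zmodType)
    (D : preHilbert C) (pi : grpalg C G -> D -> D) (h : {additive G -> D})
    (psi : grpalg C G -> C) :
  is_schurmann_triple (@augmentation C G) pi (lin_ext h) psi ->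
  forall x y, inner (h x) (h y) = inner (h y) (h x).
Proof.
move=> /schurmann_inner_sym sym x y; apply: oppr_inj.
have := sym (grpalg_base 1 x) (grpalg_base 1 y).
rewrite -[star (grpalg_base _ x)]/(grpalg_star _).
rewrite -[star (grpalg_base _ y)]/(grpalg_star _).
by rewrite !grpalg_starU !lin_extU conjC1 !scale1r !raddfN /inner !linearNr.
Qed.

Lemma eps_rep_star_rep (C : numClosedFieldType) (G : zmodType)
    (D : preHilbert C) :
  is_star_rep (@eps_rep C (grpalg C G) (@augmentation C G) D).
Proof.
rewrite /eps_rep; split.
- by move=> a c u v; rewrite scalerDr !scalerA mulrC.
- by move=> u c a b; rewrite augmentationD augmentationZ scalerDl scalerA.
- by move=> u; rewrite augmentation1 scale1r.
- by move=> a b u; rewrite augmentationM scalerA.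
move=> a u v; rewrite /inner linearZr_LR linearZl_LR.
by rewrite augmentation_star /= conjCK.
Qed.

Lemma property_AC_GC (C : numClosedFieldType) (G : zmodType) :
  property_AC (@augmentation C G) -> property_GC (@augmentation C G).
Proof.
move=> hAC D eta [eta_lin etaM]; apply: hAC; first exact: eps_rep_star_rep.
by split.
Qed.

(** Row vectors of length one, rather than C over itself, because they carry the
    standard dot product. *)
Definition line (C : numClosedFieldType) : preHilbert C :=
  PreHilbert (@dotmx C 1).

Lemma inner_line (C : numClosedFieldType) (a b : C) :
  inner (const_mx a : line C) (const_mx b) = a^* * b.
Proof. by rewrite /inner /= dotmxE mxE big_ord1 !mxE mulrC. Qed.

Section AdditiveMapToLine.
Variables (C : numClosedFieldType) (G : zmodType) (h : {additive G -> C}).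

Definition to_line (x : G) : line C := const_mx (h x).

Fact to_line_additive : zmod_morphism to_line.
Proof. by move=> x y; apply/rowP=> j; rewrite !mxE raddfB. Qed.

HB.instance Definition _ :=
  GRing.isZmodMorphism.Build G (line C) to_line to_line_additive.

(** The two sides are the inner products of the values at x and y of the Gaussian
    cocycle that extends h, in the two orders. *)
Lemma not_GC_additive (x y : G) :
  (h x)^* * h y != (h y)^* * h x -> ~ property_GC (@augmentation C G).
Proof.
move=> /eqP neq /(_ _ _ (lin_ext_gaussian to_line)) [psi triple].
by apply: neq; rewrite -!inner_line; apply: (schurmann_additive_sym triple).
Qed.

End AdditiveMapToLine.

Section GaussianCoordinates.
Variables (C : numClosedFieldType) (n : nat) (i j : 'I_n).

Definition gauss (x : 'rV[int]_n) : C := (x 0 i)%:~R + 'i * (x 0 j)%:~R.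

Fact gauss_additive : zmod_morphism gauss.
Proof.
by move=> x y; rewrite /gauss !mxE !rmorphB mulrBr opprD addrACA.
Qed.

HB.instance Definition _ :=
  GRing.isZmodMorphism.Build 'rV[int]_n C gauss gauss_additive.

End GaussianCoordinates.

Theorem mainTheorem10 (R : realType) (k : nat) (hk : (2 <= k)%N) :
  ~ property_GC (@augmentation R[i] 'rV[int]_k) /\
  ~ property_AC (@augmentation R[i] 'rV[int]_k).
Proof.
set i0 : 'I_k := Ordinal (ltnW hk); set i1 : 'I_k := Ordinal hk.
suff nGC : ~ property_GC (@augmentation R[i] 'rV[int]_k).
  by split=> // /property_AC_GC.
apply: (@not_GC_additive _ _ (gauss R[i] i0 i1) (delta_mx 0 i0) (delta_mx 0 i1)).
rewrite /= /gauss !mxE /= mulr0 mulr1 add0r addr0 conjC1 mul1r mulr1.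
(* i differs from its conjugate -i because 2i is nonzero. *)
by rewrite conjCi -subr_eq0 opprK -mulr2n mulrn_eq0 /= neq0Ci.
Qed.
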